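(* Let $\beta = (\beta_n)_{n \geq 0}$ be a sequence of positive numbers such that $\lim_{n \to \infty} \beta_n^{1/n} = 1$. If every symbol $\varphi \in H^2(\beta)$ induces a bounded composition operator $C_\varphi$ on $H^2(\beta)$, then $\beta$ is slowly oscillating.
   Context: $\mathbb{D}$ is the open unit disk of $\mathbb{C}$. For a sequence $\beta = (\beta_n)_{n\geq 0}$ of positive numbers with $\liminf_{n\to\infty} \beta_n^{1/n} \geq 1$, the weighted Hardy space $H^2(\beta)$ is the Hilbert space of analytic functions $f(z) = \sum_{n=0}^\infty a_n z^n$ on $\mathbb{D}$ such that $\|f\|^2 := \sum_{n=0}^\infty |a_n|^2 \beta_n < +\infty$. A symbol is a non-constant analytic map $\varphi\colon \mathbb{D} \to \mathbb{D}$; its composition operator is $C_\varphi(f) = f\circ\varphi$. Saying that $\varphi$ induces a bounded composition operator on $H^2(\beta)$ means that $C_\varphi$ maps $H^2(\beta)$ into itself and is a bounded operator there. The sequence $\beta$ is slowly oscillating if there are constants $0 < c < 1 < C$ such that $c\,\beta_n \leq \beta_m \leq C\,\beta_n$ whenever $n/2 \leq m \leq 2n$. *)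

(* Defs.v *)
From Stdlib Require Import Reals.
From Coquelicot Require Import Coquelicot.
Open Scope R_scope.

(** Functions on the open unit disk are represented by total functions
    [C -> C]; only their values on [in_disk] are ever used. *)
Definition in_disk (z : C) : Prop := Cmod z < 1.

(** Such an [a] is unique (the Taylor coefficients of [f] at 0), and such an
    [f] is automatically holomorphic on the disk. *)
Definition taylor_on_disk (f : C -> C) (a : nat -> C) : Prop :=
  forall z : C, in_disk z -> is_pseries a z (f z).

Definition weighted_summable (beta : nat -> R) (a : nat -> C) : Prop :=
  ex_series (fun n : nat => Cmod (a n) ^ 2 * beta n).

Definition H2 (beta : nat -> R) (f : C -> C) : Prop :=
  exists a : nat -> C, taylor_on_disk f a /\ weighted_summable beta a.

(** The norm of a function of [H2 beta] with Taylor coefficients [a]; it is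
    meaningful only when [weighted_summable beta a]. *)
Definition H2_norm (beta : nat -> R) (a : nat -> C) : R :=
  sqrt (Series (fun n : nat => Cmod (a n) ^ 2 * beta n)).

Definition symbol (phi : C -> C) : Prop :=
  (forall z : C, in_disk z -> in_disk (phi z)) /\
  (forall z : C, in_disk z -> ex_derive phi z) /\
  (exists z w : C, in_disk z /\ in_disk w /\ phi z <> phi w).

Definition comp_op (phi f : C -> C) : C -> C := fun z : C => f (phi z).

Definition bounded_comp_op (beta : nat -> R) (phi : C -> C) : Prop :=
  (forall f : C -> C, H2 beta f -> H2 beta (comp_op phi f)) /\
  (exists M : R, forall (f : C -> C) (a b : nat -> C),
     H2 beta f -> taylor_on_disk f a -> taylor_on_disk (comp_op phi f) b ->
     H2_norm beta b <= M * H2_norm beta a).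

(** The bounds on [m] say n/2 <= m <= 2n, without the truncated division. *)
Definition slowly_oscillating (beta : nat -> R) : Prop :=
  exists c C : R, 0 < c /\ c < 1 /\ 1 < C /\
    forall n m : nat, (n <= 2 * m)%nat -> (m <= 2 * n)%nat ->
      c * beta n <= beta m /\ beta m <= C * beta n.

(* Main.v *)
Require Import Defs.
From Stdlib Require Import Reals Lra Lia.
From Coquelicot Require Import Coquelicot.
Open Scope R_scope.

(** A single symbol suffices: the involution [b(z) = (1 - 2 z) / (2 - z)], whose
    powers have geometrically decaying coefficients, so that it lies in
    [H2 beta].  Write [coef n k] for the coefficient of [z^k] in [b^n].  Testing
    [C_b] on [z^n], then on a truncated sum of the [+- |coef n k| z^k], gives
    [(sum_k |coef n k| |coef k m|)^2 beta m <= M^4 beta n], so it is enough to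
    bound the sum below by a constant when [n / 2 <= m <= 2 n].

    The symmetry [k coef n k = n coef k n] turns [v k = coef k n] into a solution
    of [v (k + 1) + v (k - 1) = x_k v k] with [x_k = 5/2 - (3/2) n / k].  Up to
    signs, [v] and [v (k + 1) - v (k - 1)] are the coefficients of [(b^n)' / n] and
    [(z^2 - 1) (b^n)' / n]; since multiplication by [b] is isometric, their l^2
    norms do not depend on [n].  Hence [sum (4 - x_k^2) v_k^2] is bounded below,
    which puts a fixed mass in the range [|x_k| <= 39/20].  There the quadratic
    form [v_k^2 + v_(k+1)^2 - x_k v_k v_(k+1)] varies by bounded factors, so it is
    everywhere at least [c / n]; where moreover [x_k >= 1/10], two of any three
    consecutive [v_k^2] are at least [c' / n].  Among three consecutive indices
    there is therefore one that is good for both [n] and [m]. *)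

(** * Finite real sums, and the coefficients of the powers of [b] *)

Lemma sum_n_S_R (a : nat -> R) (N : nat) : (sum_n a (S N) : R) = sum_n a N + a (S N).
Proof. exact (sum_Sn a N). Qed.

Lemma sum_n_0_R (a : nat -> R) : (sum_n a 0 : R) = a O.
Proof. exact (sum_O a). Qed.

Lemma sum_n_plus_R (a b : nat -> R) (N : nat) :
  (sum_n (fun k => a k + b k) N : R) = sum_n a N + sum_n b N.
Proof. exact (sum_n_plus a b N). Qed.

(* [coef n k] is the coefficient of [z^k] in [((1 - 2 z) / (2 - z))^n]; the
   recursion is [(2 - z) b^(n+1) = (1 - 2 z) b^n]. *)
Fixpoint coef (n : nat) : nat -> R :=
  match n with
  | O => fun k => match k with O => 1 | S _ => 0 end
  | S n' =>
    fix row (k : nat) : R :=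
      match k with
      | O => coef n' O / 2
      | S k' => (row k' + coef n' (S k') - 2 * coef n' k') / 2
      end
  end.

Lemma coef_S_0 (n : nat) : coef (S n) 0 = coef n 0 / 2.
Proof. reflexivity. Qed.

Lemma coef_S_S (n k : nat) :
  2 * coef (S n) (S k) = coef (S n) k + coef n (S k) - 2 * coef n k.
Proof. change (coef (S n) (S k)) with ((coef (S n) k + coef n (S k) - 2 * coef n k) / 2). lra. Qed.

(* [coef (S n) k - 2 * coef n k] is the coefficient of [w^n z^k] in
   [-3 / (2 - z - w + 2 z w)], which is symmetric in [z] and [w]. *)
Lemma coef_diff_sym (n k : nat) :
  coef (S n) k - 2 * coef n k = coef (S k) n - 2 * coef k n.
Proof.
  assert (row0 : forall j, coef 1 (S j) - 2 * coef 0 (S j) = (coef 1 j - 2 * coef 0 j) / 2).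
  { intro j. pose proof (coef_S_S 0 j) as H. destruct j as [|j].
    - simpl; lra.
    - simpl (coef 0 _) in *. lra. }
  assert (col0 : forall j, coef (S (S j)) 0 - 2 * coef (S j) 0 = (coef (S j) 0 - 2 * coef j 0) / 2).
  { intro j. rewrite !coef_S_0. lra. }
  revert k. induction n as [|n IHn]; intro k.
  - induction k as [|k IHk]; [reflexivity|]. rewrite row0, col0. lra.
  - induction k as [|k IHk].
    + rewrite row0, col0. rewrite (IHn 0%nat). lra.
    + pose proof (IHn k). pose proof (IHn (S k)).
      pose proof (coef_S_S (S n) k). pose proof (coef_S_S n k).
      pose proof (coef_S_S (S k) n). pose proof (coef_S_S k n). lra.
Qed.

(** Conceptually, [INR k * coef n k] is the Dirichlet pairing of [b^n] with [z^k]; composition with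
    the involution [b] preserves the pairing and turns it into that of [z^n] with [b^k]. The proof
    is a double induction from the recursion in both index orders and [coef_diff_sym]. *)
Lemma coef_sym (n k : nat) : INR k * coef n k = INR n * coef k n.
Proof.
  revert k. induction n as [|n IHn]; intro k.
  - destruct k as [|k]; simpl coef; simpl INR; ring.
  - induction k as [|k IHk].
    + simpl coef; simpl INR; ring.
    + pose proof (coef_S_S n k) as H1. pose proof (coef_S_S k n) as H2.
      pose proof (coef_diff_sym n k) as H3.
      pose proof (IHn k) as H4. pose proof (IHn (S k)) as H5.
      rewrite !S_INR in *. nra.
Qed.

(** [coef_diff_sym] trades row [S n] of the recursion for column [n]; the only term left outside
    that column is [coef n (S k)], which [coef_sym] converts. *)
Lemma coef_three_term (n k : nat) :
  INR (S k) * (2 * coef (S (S k)) n + 2 * coef k n)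
  = (5 * INR (S k) - 3 * INR n) * coef (S k) n.
Proof.
  pose proof (coef_diff_sym n (S k)) as H1. pose proof (coef_diff_sym n k) as H2.
  pose proof (coef_S_S n k) as H3. pose proof (coef_sym n (S k)) as H4.
  replace (2 * coef (S (S k)) n + 2 * coef k n) with (5 * coef (S k) n - 3 * coef n (S k)) by lra.
  lra.
Qed.

(** This is [(b^k)' = k b^(k-1) b'] at 0, where [b(0) = 1/2] and [b'(0) = -3/4]. *)
Lemma coef_1_r (k : nat) : coef k 1 = - (3 / 2) * (INR k * (1 / 2) ^ k).
Proof.
  pose proof (coef_sym 1 k) as H. simpl (INR 1) in H.
  destruct k as [|k]; [simpl in *; lra|].
  assert (E : coef 1 (S k) = - (3 / 2) * (1 / 2) ^ S k).
  { clear H. induction k as [|k IHk]; [simpl; lra|].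
    pose proof (coef_S_S 0 (S k)) as H. simpl (coef 0 _) in H.
    rewrite IHk in H. simpl ((1/2)^ _) in *. lra. }
  rewrite E in H. lra.
Qed.

(** * Norms independent of the exponent *)

Lemma is_series_nonneg_bounded (a : nat -> R) (B : R) :
  (forall n, 0 <= a n) -> (forall n, sum_n a n <= B) ->
  exists s, is_series a s /\ s <= B.
Proof.
  intros a0 HB.
  assert (incr : forall n, sum_n a n <= sum_n a (S n)).
  { intro n. rewrite sum_n_S_R. specialize (a0 (S n)). lra. }
  destruct (ex_finite_lim_seq_incr (sum_n a) B incr HB) as [s Hs].
  exists s; split.
  - exact Hs.
  - apply (is_lim_seq_le _ _ s B HB Hs). apply is_lim_seq_const.
Qed.

Lemma sum_n_le_is_series (a : nat -> R) (s : R) (n : nat) :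
  (forall k, 0 <= a k) -> is_series a s -> sum_n a n <= s.
Proof.
  intros a0 Hs.
  apply (is_lim_seq_incr_compare (sum_n a) s Hs).
  intro k. rewrite sum_n_S_R. specialize (a0 (S k)). lra.
Qed.

Lemma is_series_lim_0 (a : nat -> R) (s : R) : is_series a s -> is_lim_seq a 0.
Proof. intro H. apply ex_series_lim_0. now exists s. Qed.

(* The relation says that [h] is the product of [g] and the Blaschke factor
   [(1 - 2 z) / (2 - z)], so that multiplication by it is an isometry. *)
Lemma blaschke_sum_sqr (g h : nat -> R) (N : nat) :
  2 * h O = g O -> (forall k, 2 * h (S k) - h k = g (S k) - 2 * g k) ->
  sum_n (fun k => h k ^ 2) N + (2 * g N - h N) ^ 2 / 3 = sum_n (fun k => g k ^ 2) N.
Proof.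
  intros H0 H. induction N as [|N IH].
  - rewrite !sum_n_0_R. nra.
  - rewrite !sum_n_S_R, <- IH. pose proof (H N) as HN.
    replace (h N) with (2 * h (S N) - g (S N) + 2 * g N) by lra.
    simpl. field.
Qed.

(** The boundary term [(2 * g N - h N) ^ 2 / 3] of [blaschke_sum_sqr] tends to 0, because both
    sequences are square summable. *)
Lemma blaschke_isometry (g h : nat -> R) (s : R) :
  2 * h O = g O -> (forall k, 2 * h (S k) - h k = g (S k) - 2 * g k) ->
  is_series (fun k => g k ^ 2) s -> is_series (fun k => h k ^ 2) s.
Proof.
  intros H0 H Hs.
  assert (HN := fun N => blaschke_sum_sqr g h N H0 H).
  destruct (is_series_nonneg_bounded (fun k => h k ^ 2) s) as [s' [Hs' _]].
  { intro n. apply pow2_ge_0. }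
  { intro n. apply Rle_trans with (sum_n (fun k => g k ^ 2) n).
    - rewrite <- HN. pose proof (pow2_ge_0 (2 * g n - h n)). lra.
    - apply sum_n_le_is_series; [intro; apply pow2_ge_0 | exact Hs]. }
  assert (Hq : is_lim_seq (fun N => (2 * g N - h N) ^ 2 / 3) 0).
  { apply is_lim_seq_le_le with (u := fun _ => 0) (w := fun N => 3 * g N ^ 2 + h N ^ 2).
    - intro n. pose proof (pow2_ge_0 (2 * g n - h n)).
      pose proof (pow2_ge_0 (g n)). pose proof (pow2_ge_0 (h n)).
      pose proof (pow2_ge_0 (g n + h n)). nra.
    - apply is_lim_seq_const.
    - replace (Finite 0) with (Rbar_plus (Rbar_mult 3 0) 0) by (simpl; f_equal; ring).
      apply is_lim_seq_plus'.
      + apply (is_lim_seq_scal_l (fun N => g N ^ 2) 3 0). now apply is_series_lim_0 with s.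
      + now apply is_series_lim_0 with s'. }
  assert (Hl : is_lim_seq (sum_n (fun k => h k ^ 2)) s).
  { apply is_lim_seq_ext with (fun N => sum_n (fun k => g k ^ 2) N - (2 * g N - h N) ^ 2 / 3).
    { intro N. rewrite <- HN. lra. }
    replace s with (s - 0) by ring. apply is_lim_seq_minus'; [exact Hs | exact Hq]. }
  exact Hl.
Qed.

(* Up to signs, the coefficients of [(z^2 - 1) F'], where [F'] has
   coefficients [v (k + 1)]. *)
Definition gap (v : nat -> R) (k : nat) : R :=
  match k with O => v 1%nat | S j => v (S (S j)) - v j end.

Lemma coef_1_r_sum_sqr (N : nat) : sum_n (fun k => coef k 1 ^ 2) N <= 5 / 3.
Proof.
  (* The limit 5/3 is [9/4] times the sum of [k^2 / 4^k]; the subtracted term is the tail in closed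
     form. *)
  assert (E : sum_n (fun k => coef k 1 ^ 2) N
    = 5 / 3 - (9 * INR N ^ 2 + 24 * INR N + 20) / 12 * ((1 / 2) ^ N) ^ 2).
  { induction N as [|N IH].
    - rewrite sum_n_0_R. simpl. lra.
    - rewrite sum_n_S_R, IH, coef_1_r, S_INR. simpl. field. }
  rewrite E. pose proof (pos_INR N). pose proof (pow2_ge_0 ((1 / 2) ^ N)).
  assert (0 <= (9 * INR N ^ 2 + 24 * INR N + 20) / 12) by nra. nra.
Qed.

(** Passing from column [S n] to column [S (S n)] multiplies both generating functions in [k] by
    [b], so that only the explicit column 1 has to be estimated. *)
Lemma coef_sqr_series :
  exists s t, s <= 5 / 3 /\ 9 / 8 <= t /\ forall n : nat,
    is_series (fun k => coef k (S n) ^ 2) s /\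
    is_series (fun k => gap (fun j => coef j (S n)) k ^ 2) t.
Proof.
  destruct (is_series_nonneg_bounded (fun k => coef k 1 ^ 2) (5 / 3)) as [s [Hs Hs']].
  { intro; apply pow2_ge_0. }
  { apply coef_1_r_sum_sqr. }
  assert (Hex : ex_series (fun k => gap (fun j => coef j 1) k ^ 2)).
  { apply ex_series_incr_1.
    apply (ex_series_le (K := R_AbsRing) (V := R_CompleteNormedModule)
      _ (fun k => 2 * coef (S (S k)) 1 ^ 2 + 2 * coef k 1 ^ 2)).
    - intro k.
      change (Rabs ((coef (S (S k)) 1 - coef k 1) ^ 2) <= 2 * coef (S (S k)) 1 ^ 2 + 2 * coef k 1 ^ 2).
      rewrite Rabs_pos_eq by (apply pow2_ge_0).
      pose proof (pow2_ge_0 (coef (S (S k)) 1 + coef k 1)). nra.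
    - apply (ex_series_plus (V := R_NormedModule) (fun k => 2 * coef (S (S k)) 1 ^ 2)).
      + apply (ex_series_scal 2 (fun k => coef (S (S k)) 1 ^ 2)).
        apply (ex_series_incr_1 (fun k => coef (S k) 1 ^ 2)).
        apply (ex_series_incr_1 (fun k => coef k 1 ^ 2)). now exists s.
      + apply (ex_series_scal 2 (fun k => coef k 1 ^ 2)). now exists s. }
  destruct Hex as [t Ht].
  exists s, t. split; [exact Hs'|]. split.
  (* The first two terms are 9/16 each. *)
  { apply Rle_trans with (sum_n (fun k => gap (fun j => coef j 1) k ^ 2) 1).
    - rewrite sum_n_S_R, sum_n_0_R. unfold gap. rewrite !coef_1_r. simpl. lra.
    - apply sum_n_le_is_series; [intro; apply pow2_ge_0 | exact Ht]. }
  (* Columns of positive index start with 0; the initial conditions of [blaschke_isometry] rest on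
     this. *)
  assert (Z : forall n, coef 0 (S n) = 0) by (intro; reflexivity).
  induction n as [|n [IH1 IH2]]; [now split|]. split.
  - apply blaschke_isometry with (3 := IH1).
    + rewrite !Z; ring.
    + intro k. pose proof (coef_S_S k (S n)). lra.
  - apply blaschke_isometry with (3 := IH2).
    + unfold gap. pose proof (coef_S_S 0 (S n)). rewrite !Z in *. lra.
    + intros [|k]; unfold gap.
      * pose proof (coef_S_S 0 (S n)). pose proof (coef_S_S 1 (S n)). rewrite !Z in *. lra.
      * pose proof (coef_S_S k (S n)). pose proof (coef_S_S (S (S k)) (S n)). lra.
Qed.

(** * The recurrence in the elliptic range *)

(** The [x_k] of the overview. It lies strictly between -2 and 2, where solutions oscillate, exactly
    for [n / 3 < k < 3 n]. *)
Definition potential (n k : nat) : R := 5 / 2 - 3 / 2 * (INR n / INR k).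

Lemma coef_schroedinger (n k : nat) :
  coef (S (S k)) n + coef k n = potential n (S k) * coef (S k) n.
Proof.
  pose proof (coef_three_term n k) as H.
  assert (Hk : INR (S k) <> 0) by (apply not_0_INR; lia).
  apply Rmult_eq_reg_l with (2 * INR (S k)); [|lra].
  transitivity ((5 * INR (S k) - 3 * INR n) * coef (S k) n); [lra|].
  unfold potential. field. exact Hk.
Qed.

(* The junk value of [potential] at [k = 0] is multiplied by [coef 0 (S n) = 0]. *)
Lemma sum_potential (n N : nat) :
  (sum_n (fun k => (4 - potential (S n) k ^ 2) * coef k (S n) ^ 2) N : R)
  = sum_n (fun k => gap (fun j => coef j (S n)) k ^ 2) N
    + coef 1 (S n) ^ 2 - 2 * coef (S N) (S n) ^ 2 + 2 * coef N (S n) ^ 2.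
Proof.
  induction N as [|N IH].
  - rewrite !sum_n_0_R. unfold gap. change (coef 0 (S n)) with 0. ring.
  - rewrite !sum_n_S_R, IH.
    pose proof (coef_schroedinger (S n) N) as H.
    unfold gap.
    replace ((4 - potential (S n) (S N) ^ 2) * coef (S N) (S n) ^ 2) with
      (4 * coef (S N) (S n) ^ 2 - (potential (S n) (S N) * coef (S N) (S n)) ^ 2) by ring.
    rewrite <- H. ring.
Qed.

(** The bound [|potential| <= 39/20], at a fixed distance from 2, with denominators cleared so that
    it is linear in [n] and [k]. *)
Definition elliptic (n k : nat) : Prop :=
  (11 * k <= 30 * n)%nat /\ (30 * n <= 89 * k)%nat.

Lemma elliptic_potential (n k : nat) :
  (0 < k)%nat -> elliptic n k <-> Rabs (potential n k) <= 39 / 20.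
Proof.
  intro Hk. assert (Hk' : 0 < INR k) by (apply lt_0_INR; lia).
  unfold elliptic, potential.
  assert (E : INR n = INR n / INR k * INR k) by (field; lra).
  set (q := INR n / INR k) in *.
  split.
  - intros [H1 H2]. apply le_INR in H1, H2. rewrite !mult_INR, E in H1, H2.
    simpl INR in H1, H2. apply Rabs_le. split; nra.
  - intro H. apply Rabs_le_between in H.
    split; apply INR_le; rewrite !mult_INR, E; simpl (INR 11); simpl (INR 30); simpl (INR 89); nra.
Qed.

Lemma sum_n_truncated_const (c : R) (m N : nat) :
  0 <= c -> sum_n (fun k => (if Nat.leb k m then c else 0) : R) N <= (INR m + 1) * c.
Proof.
  intro Hc.
  assert (H : sum_n (fun k => (if Nat.leb k m then c else 0) : R) N <= (INR (Nat.min N m) + 1) * c).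
  { induction N as [|N IH].
    - rewrite sum_n_0_R. simpl. lra.
    - rewrite sum_n_S_R.
      destruct (Nat.leb_spec (S N) m) as [L|L].
      + rewrite Nat.min_l by lia. rewrite Nat.min_l in IH by lia. rewrite S_INR. lra.
      + rewrite Nat.min_r by lia. rewrite Nat.min_r in IH by lia. lra. }
  assert (INR (Nat.min N m) <= INR m) by (apply le_INR; lia). nra.
Qed.

Lemma sum_n_Rle (a b : nat -> R) (N : nat) :
  (forall k, a k <= b k) -> sum_n a N <= sum_n b N.
Proof. intro H. apply sum_n_m_le. exact H. Qed.

(* The sum of [(4 - potential^2) coef^2] is bounded below, and its terms
   outside the elliptic range are negative or negligible. *)
Lemma elliptic_mass (n : nat) (B : R) :
  (forall k, elliptic (S n) k -> coef k (S n) ^ 2 <= B) ->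
  1 / 6 <= (3 * INR (S n) + 1) * B.
Proof.
  intro HB.
  assert (B0 : 0 <= B).
  { apply Rle_trans with (coef (S n) (S n) ^ 2); [apply pow2_ge_0|].
    apply HB. unfold elliptic. lia. }
  destruct coef_sqr_series as (s & t & Hs & Ht & H). destruct (H n) as [H1 H2]. clear H.
  (* For large [N] the right side of [sum_potential] is at least [9/8 - 1/32 - 2/32]. *)
  assert (HN : exists N, 1 <= sum_n (fun k => (4 - potential (S n) k ^ 2) * coef k (S n) ^ 2) N).
  { assert (L1 : is_lim_seq (sum_n (fun k => gap (fun j => coef j (S n)) k ^ 2)) t) by exact H2.
    assert (L2 := is_series_lim_0 _ _ H1).
    apply is_lim_seq_incr_1 in L2.
    apply is_lim_seq_spec in L1. apply is_lim_seq_spec in L2.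
    assert (e : 0 < 1 / 32) by lra.
    destruct (L1 (mkposreal _ e)) as [N1 HN1]. destruct (L2 (mkposreal _ e)) as [N2 HN2].
    exists (N1 + N2)%nat. specialize (HN1 (N1 + N2)%nat ltac:(lia)).
    specialize (HN2 (N1 + N2)%nat ltac:(lia)). simpl pos in *.
    rewrite sum_potential.
    apply Rabs_lt_between in HN1. apply Rabs_lt_between in HN2.
    pose proof (pow2_ge_0 (coef 1 (S n))). pose proof (pow2_ge_0 (coef (N1 + N2) (S n))). lra. }
  destruct HN as [N HN].
  (* Elliptic indices are at most [3 * S n]. At the others the factor is below
     [4 - (39/20)^2 < 1/5], for a total of at most [1/5 * 5/3 = 1/3]. *)
  assert (Hle : forall k, (4 - potential (S n) k ^ 2) * coef k (S n) ^ 2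
     <= (if Nat.leb k (3 * S n) then 4 * B else 0) + 1 / 5 * coef k (S n) ^ 2).
  { intro k. pose proof (pow2_ge_0 (coef k (S n))) as P.
    destruct k as [|k]; [change (coef 0 (S n)) with 0; destruct (Nat.leb _ _); nra|].
    pose proof (elliptic_potential (S n) (S k) ltac:(lia)) as El.
    destruct (Rle_lt_dec (Rabs (potential (S n) (S k))) (39 / 20)) as [D|D].
    - apply El in D. pose proof (HB _ D) as D'.
      replace (Nat.leb (S k) (3 * S n)) with true.
      2:{ symmetry. apply Nat.leb_le. destruct D; lia. }
      pose proof (pow2_ge_0 (potential (S n) (S k))). nra.
    - assert (Q : (39 / 20) ^ 2 <= potential (S n) (S k) ^ 2).
      { rewrite <- (pow2_abs (potential _ _)). apply pow_incr. lra. }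
      assert (0 <= if Nat.leb (S k) (3 * S n) then 4 * B else 0) by (destruct (Nat.leb _ _); lra).
      nra. }
  apply (sum_n_Rle _ _ N) in Hle. rewrite sum_n_plus_R in Hle.
  assert (T1 := sum_n_truncated_const (4 * B) (3 * S n) N ltac:(lra)).
  assert (T2 : sum_n (fun k => 1 / 5 * coef k (S n) ^ 2) N <= 1 / 5 * s).
  { rewrite (sum_n_mult_l (K := R_Ring) (1 / 5)). apply Rmult_le_compat_l; [lra|].
    apply sum_n_le_is_series; [intro; apply pow2_ge_0 | exact H1]. }
  rewrite mult_INR in T1. simpl (INR 3) in T1.
  lra.
Qed.

(** The quadratic form that the recurrence would conserve if the potential were constant. *)
Definition energy (n k : nat) : R :=
  coef k n ^ 2 + coef (S k) n ^ 2 - potential n k * coef k n * coef (S k) n.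

Lemma energy_S (n k : nat) :
  energy n (S k) - energy n k
  = (potential n k - potential n (S k)) * (coef k n * coef (S k) n).
Proof.
  unfold energy.
  replace (coef (S (S k)) n) with (potential n (S k) * coef (S k) n - coef k n)
    by (rewrite <- coef_schroedinger; ring).
  ring.
Qed.

(** The recurrence replaces [coef k n] by the other root of the same quadratic polynomial. Both
    [energy n k] and [energy n (S k)] are therefore forms in the same pair of coefficients. *)
Lemma energy_S_alt (n k : nat) :
  energy n (S k)
  = coef k n ^ 2 + coef (S k) n ^ 2 - potential n (S k) * coef k n * coef (S k) n.
Proof.
  unfold energy.
  replace (coef (S (S k)) n) with (potential n (S k) * coef (S k) n - coef k n)
    by (rewrite <- coef_schroedinger; ring).
  ring.
Qed.

(** The form equals [(2 - x) (u + v)^2 / 4 + (2 + x) (u - v)^2 / 4], and both [2 - x] and [2 + x]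
    are at least 1/20. *)
Lemma form_lower (x u v : R) :
  Rabs x <= 39 / 20 -> u ^ 2 + v ^ 2 <= 40 * (u ^ 2 + v ^ 2 - x * u * v).
Proof.
  intro H. apply Rabs_le_between in H.
  pose proof (pow2_ge_0 (u - v)). pose proof (pow2_ge_0 (u + v)).
  assert (0 <= (2 - x) * (u + v) ^ 2) by (apply Rmult_le_pos; lra).
  assert (0 <= (2 + x) * (u - v) ^ 2) by (apply Rmult_le_pos; lra).
  nra.
Qed.

Lemma form_upper (x u v : R) :
  Rabs x <= 39 / 20 -> u ^ 2 + v ^ 2 - x * u * v <= 2 * (u ^ 2 + v ^ 2).
Proof.
  intro H. apply Rabs_le_between in H.
  pose proof (pow2_ge_0 (u - v)). pose proof (pow2_ge_0 (u + v)).
  assert (0 <= (2 - x) * (u - v) ^ 2) by (apply Rmult_le_pos; lra).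
  assert (0 <= (2 + x) * (u + v) ^ 2) by (apply Rmult_le_pos; lra).
  nra.
Qed.

Lemma elliptic_pos (n k : nat) : (0 < n)%nat -> elliptic n k -> (0 < k)%nat.
Proof. unfold elliptic. lia. Qed.

(** The change is at most the drift of the potential, [27 / (2 n)], times half the sum of squares,
    itself at most 20 times either energy; this gives 270. *)
Lemma energy_step (n k : nat) :
  (0 < n)%nat -> elliptic n k -> elliptic n (S k) ->
  energy n (S k) <= (1 + 270 / INR n) * energy n k /\
  energy n k <= (1 + 270 / INR n) * energy n (S k).
Proof.
  intros Hn E1 E2.
  pose proof (elliptic_pos n k Hn E1) as Hk.
  pose proof (energy_S n k) as HE.
  assert (F1 : coef k n ^ 2 + coef (S k) n ^ 2 <= 40 * energy n k).
  { apply form_lower. now apply elliptic_potential. }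
  assert (F2 : coef k n ^ 2 + coef (S k) n ^ 2 <= 40 * energy n (S k)).
  { rewrite energy_S_alt. apply form_lower. apply elliptic_potential; [lia|exact E2]. }
  (* The drift is [3 n / (2 k (k + 1))], and [n <= 3 k] in the elliptic range. *)
  assert (P : Rabs (potential n k - potential n (S k)) <= 27 / 2 / INR n).
  { assert (Hn' : 0 < INR n) by (apply lt_0_INR; lia).
    assert (Hk' : 0 < INR k) by (apply lt_0_INR; lia).
    destruct E1 as [_ L]. apply le_INR in L. rewrite !mult_INR in L. simpl INR in L.
    unfold potential. rewrite S_INR.
    replace (5 / 2 - 3 / 2 * (INR n / INR k) - (5 / 2 - 3 / 2 * (INR n / (INR k + 1))))
      with (- (3 / 2 * INR n / (INR k * (INR k + 1)))) by (field; lra).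
    assert (0 < INR k * (INR k + 1)) by nra.
    rewrite Rabs_Ropp, Rabs_pos_eq.
    2:{ apply Rmult_le_pos; [lra|]. left. now apply Rinv_0_lt_compat. }
    apply Rmult_le_reg_r with (INR n * (INR k * (INR k + 1))); [nra|].
    replace (3 / 2 * INR n / (INR k * (INR k + 1)) * (INR n * (INR k * (INR k + 1))))
      with (3 / 2 * INR n * INR n) by (field; lra).
    replace (27 / 2 / INR n * (INR n * (INR k * (INR k + 1))))
      with (27 / 2 * (INR k * (INR k + 1))) by (field; lra).
    assert (INR n <= 3 * INR k) by lra. nra. }
  assert (Q : Rabs (coef k n * coef (S k) n) <= (coef k n ^ 2 + coef (S k) n ^ 2) / 2).
  { pose proof (pow2_ge_0 (coef k n - coef (S k) n)). pose proof (pow2_ge_0 (coef k n + coef (S k) n)).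
    apply Rabs_le. nra. }
  assert (D : Rabs (energy n (S k) - energy n k)
     <= 27 / 2 / INR n * ((coef k n ^ 2 + coef (S k) n ^ 2) / 2)).
  { rewrite HE, Rabs_mult. apply Rmult_le_compat; auto using Rabs_pos. }
  assert (i : 0 < / INR n) by (apply Rinv_0_lt_compat, lt_0_INR; lia).
  unfold Rdiv in *. apply Rabs_le_between in D. split; nra.
Qed.

Lemma elliptic_between (n i j k : nat) :
  elliptic n i -> elliptic n j -> (i <= k <= j)%nat -> elliptic n k.
Proof. unfold elliptic. lia. Qed.

Lemma energy_nonneg (n k : nat) : (0 < n)%nat -> elliptic n k -> 0 <= energy n k.
Proof.
  intros Hn E. pose proof (elliptic_pos n k Hn E).
  assert (F : coef k n ^ 2 + coef (S k) n ^ 2 <= 40 * energy n k).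
  { apply form_lower. now apply elliptic_potential. }
  pose proof (pow2_ge_0 (coef k n)). pose proof (pow2_ge_0 (coef (S k) n)). lra.
Qed.

Lemma energy_iter (n i d : nat) :
  (0 < n)%nat -> elliptic n i -> elliptic n (i + d) ->
  energy n (i + d) <= (1 + 270 / INR n) ^ d * energy n i /\
  energy n i <= (1 + 270 / INR n) ^ d * energy n (i + d).
Proof.
  intros Hn Ei. induction d as [|d IH]; intro Ed.
  - rewrite Nat.add_0_r. simpl. lra.
  - assert (E' : elliptic n (i + d)).
    { apply elliptic_between with i (i + S d)%nat; auto. lia. }
    destruct (IH E') as [I1 I2].
    rewrite Nat.add_succ_r in *.
    destruct (energy_step n (i + d) Hn E' Ed) as [S1 S2].
    assert (0 < / INR n) by (apply Rinv_0_lt_compat, lt_0_INR; lia).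
    assert (0 <= (1 + 270 / INR n)) by (unfold Rdiv; lra).
    assert (0 <= (1 + 270 / INR n) ^ d) by (apply pow_le; lra).
    split; simpl pow.
    + apply Rle_trans with (1 := S1). rewrite Rmult_assoc.
      now apply Rmult_le_compat_l.
    + apply Rle_trans with (1 := I2). rewrite (Rmult_comm (1 + _)), Rmult_assoc.
      now apply Rmult_le_compat_l.
Qed.

(** Two elliptic indices are at most [3 n] steps apart, and [(1 + 270 / n)^(3 n) <= exp 810]. *)
Lemma energy_comparable (n i j : nat) :
  (0 < n)%nat -> elliptic n i -> elliptic n j -> energy n i <= exp 810 * energy n j.
Proof.
  intros Hn Ei Ej.
  assert (Hn' : 0 < INR n) by (apply lt_0_INR; lia).
  assert (i0 : 0 < / INR n) by (apply Rinv_0_lt_compat; lra).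
  assert (B : forall d, (d <= 3 * n)%nat -> (1 + 270 / INR n) ^ d <= exp 810).
  { intros d Hd. apply le_INR in Hd. rewrite mult_INR in Hd. simpl (INR 3) in Hd.
    apply Rle_trans with (exp (270 / INR n) ^ d).
    - apply pow_incr. split; [unfold Rdiv; lra|]. left. apply exp_ineq1. unfold Rdiv; lra.
    - assert (X : exp (270 / INR n) ^ d = exp (INR d * (270 / INR n))).
      { clear. induction d as [|d IH]; [simpl; now rewrite Rmult_0_l, exp_0|].
        rewrite S_INR, Rmult_plus_distr_r, Rmult_1_l, exp_plus, <- IH. simpl. ring. }
      assert (Y : INR d * (270 / INR n) <= 810).
      { replace 810 with (3 * INR n * (270 / INR n)) by (field; lra).
        apply Rmult_le_compat_r; [unfold Rdiv; lra | lra]. }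
      rewrite X. destruct Y as [Y|Y]; [left; now apply exp_increasing | now rewrite Y; right]. }
  destruct (Nat.le_ge_cases i j) as [L|L].
  - replace j with (i + (j - i))%nat in * by lia.
    apply Rle_trans with (1 := proj2 (energy_iter n i (j - i) Hn Ei Ej)).
    apply Rmult_le_compat_r; [now apply energy_nonneg|]. apply B. unfold elliptic in *. lia.
  - replace i with (j + (i - j))%nat in * by lia.
    apply Rle_trans with (1 := proj1 (energy_iter n j (i - j) Hn Ej Ei)).
    apply Rmult_le_compat_r; [now apply energy_nonneg|]. apply B. unfold elliptic in *. lia.
Qed.

(** A small energy at one elliptic index would be small at all of them, against [elliptic_mass]. *)
Lemma coef_pair_lower :
  exists c, 0 < c /\ forall n k, (0 < n)%nat -> elliptic n k ->
    c / INR n <= coef k n ^ 2 + coef (S k) n ^ 2.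
Proof.
  pose proof (exp_pos 810) as X. set (Y := exp 810) in *.
  (* [1920 = 6 * 4 * 40 * 2]: the factors come from [elliptic_mass], from [3 n + 1 <= 4 n], from
     [form_lower] and from [form_upper]. *)
  exists (/ (1920 * Y)). split; [apply Rinv_0_lt_compat; lra|].
  intros [|n] k Hn Ek; [lia|].
  pose proof (elliptic_pos _ _ Hn Ek) as Hk.
  assert (U : energy (S n) k <= 2 * (coef k (S n) ^ 2 + coef (S k) (S n) ^ 2)).
  { apply form_upper. now apply elliptic_potential. }
  assert (M : 1 / 6 <= (3 * INR (S n) + 1) * (40 * (Y * energy (S n) k))).
  { apply elliptic_mass. intros j Ej.
    pose proof (elliptic_pos _ _ Hn Ej) as Hj.
    apply Rle_trans with (40 * energy (S n) j).
    - assert (F : coef j (S n) ^ 2 + coef (S j) (S n) ^ 2 <= 40 * energy (S n) j).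
      { apply form_lower. now apply elliptic_potential. }
      pose proof (pow2_ge_0 (coef (S j) (S n))). lra.
    - apply Rmult_le_compat_l; [lra|]. now apply energy_comparable. }
  assert (N1 : 1 <= INR (S n)) by (apply (le_INR 1); lia).
  pose proof (energy_nonneg _ _ Hn Ek) as E0.
  assert (M2 : 1 <= (1920 * Y) * (coef k (S n) ^ 2 + coef (S k) (S n) ^ 2) * INR (S n)).
  { set (N := INR (S n)) in *. set (e := energy (S n) k) in *.
    set (q := coef k (S n) ^ 2 + coef (S k) (S n) ^ 2) in *.
    assert (0 <= Y * e) by nra.
    assert (Y * e <= 2 * Y * q) by nra.
    assert (1 <= 960 * N * (Y * e)) by nra. nra. }
  apply Rmult_le_reg_r with (INR (S n) * (1920 * Y)); [nra|].
  replace (/ (1920 * Y) / INR (S n) * (INR (S n) * (1920 * Y))) with 1 by (field; lra).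
  lra.
Qed.

(** * Overlap of two solutions *)

Lemma Rabs_prod_lower (a b t : R) : 0 <= t -> t <= a ^ 2 -> t <= b ^ 2 -> t <= Rabs a * Rabs b.
Proof.
  intros Ht Ha Hb. rewrite <- Rabs_mult.
  apply Rsqr_incr_0; [|exact Ht|apply Rabs_pos].
  rewrite <- Rsqr_abs. unfold Rsqr. nra.
Qed.

(** Two adjacent small entries contradict a hypothesis at once. If [u] and [w] are small, so is
    [x v], hence [v] since [x] is bounded below. *)
Lemma two_of_three_large (x u v w g : R) :
  1 / 10 <= x -> 0 < g -> u + w = x * v ->
  g <= u ^ 2 + v ^ 2 -> g <= v ^ 2 + w ^ 2 ->
  (g / 1000 <= u ^ 2 /\ g / 1000 <= v ^ 2) \/
  (g / 1000 <= u ^ 2 /\ g / 1000 <= w ^ 2) \/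
  (g / 1000 <= v ^ 2 /\ g / 1000 <= w ^ 2).
Proof.
  intros Hx Hg E H1 H2.
  destruct (Rle_lt_dec (g / 1000) (u ^ 2)) as [U|U];
  destruct (Rle_lt_dec (g / 1000) (v ^ 2)) as [V|V];
  destruct (Rle_lt_dec (g / 1000) (w ^ 2)) as [W|W]; try lra; try tauto.
  exfalso.
  assert (A : (u + w) ^ 2 <= 2 * u ^ 2 + 2 * w ^ 2) by (pose proof (pow2_ge_0 (u - w)); nra).
  assert (B : (1 / 10) ^ 2 * v ^ 2 <= (x * v) ^ 2).
  { rewrite Rpow_mult_distr. apply Rmult_le_compat_r; [apply pow2_ge_0|].
    apply pow_incr. lra. }
  rewrite <- E in B. lra.
Qed.

Lemma sum_n_triples (s : nat -> R) (L q : nat) (t : R) :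
  (forall k, 0 <= s k) ->
  (forall j, (j < q)%nat ->
    t <= s (S (L + 3 * j)) + s (S (S (L + 3 * j))) + s (S (S (S (L + 3 * j))))) ->
  INR q * t <= sum_n s (L + 3 * q).
Proof.
  intros Hs. induction q as [|q IH]; intro H.
  - simpl (INR 0). rewrite Rmult_0_l. generalize (L + 3 * 0)%nat as N.
    induction N as [|N IHN]; [rewrite sum_n_0_R; apply Hs|].
    rewrite sum_n_S_R. specialize (Hs (S N)). lra.
  - replace (L + 3 * S q)%nat with (S (S (S (L + 3 * q)))) by lia.
    rewrite !sum_n_S_R, S_INR.
    pose proof (H q ltac:(lia)). pose proof (IH (fun j Hj => H j ltac:(lia))). lra.
Qed.

(** The bound [5 n <= 8 k] makes the potential at least [5/2 - 12/5 = 1/10]. The threshold depends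
    on [p] instead of [n], so that it can be shared by two exponents. *)
Lemma coef_two_of_three (c : R) (n k p : nat) :
  0 < c ->
  (forall n k, (0 < n)%nat -> elliptic n k -> c / INR n <= coef k n ^ 2 + coef (S k) n ^ 2) ->
  (0 < n)%nat -> (n <= 2 * p)%nat -> (5 * n <= 8 * k)%nat -> (11 * (k + 1) <= 30 * n)%nat ->
  let t := c / (2 * INR p) / 1000 in
  (t <= coef k n ^ 2 /\ t <= coef (S k) n ^ 2) \/
  (t <= coef k n ^ 2 /\ t <= coef (S (S k)) n ^ 2) \/
  (t <= coef (S k) n ^ 2 /\ t <= coef (S (S k)) n ^ 2).
Proof.
  intros Hc H Hn Hp H1 H2 t.
  assert (Hn' : 0 < INR n) by (apply lt_0_INR; lia).
  assert (Hp' : INR n <= 2 * INR p).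
  { apply le_INR in Hp. rewrite mult_INR in Hp. exact Hp. }
  assert (G : c / (2 * INR p) <= c / INR n).
  { unfold Rdiv. apply Rmult_le_compat_l; [lra|]. now apply Rinv_le_contravar. }
  assert (G0 : 0 < c / (2 * INR p)) by (apply Rdiv_lt_0_compat; lra).
  assert (Hk : 0 < INR (S k)) by (apply lt_0_INR; lia).
  apply two_of_three_large with (x := potential n (S k)).
  - unfold potential. apply le_INR in H1. rewrite !mult_INR in H1. simpl (INR 5) in H1.
    simpl (INR 8) in H1. rewrite S_INR in *.
    assert (Q : INR n / (INR k + 1) <= 8 / 5) by (apply Rle_div_l; lra). lra.
  - exact G0.
  - rewrite <- coef_schroedinger. ring.
  - apply Rle_trans with (1 := G). apply H; [exact Hn|]. unfold elliptic; lia.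
  - apply Rle_trans with (1 := G). apply H; [exact Hn|]. unfold elliptic; lia.
Qed.

Lemma coef_overlap :
  exists d, 0 < d /\ forall n m, (n <= 2 * m)%nat -> (m <= 2 * n)%nat ->
    (8 <= n)%nat -> (8 <= m)%nat ->
    exists N, d <= sum_n (fun k => Rabs (coef n k) * Rabs (coef k m)) N.
Proof.
  destruct coef_pair_lower as (c & Hc & H).
  (* At least [p / 8] triples contribute [t / 2] each, with [t = c / (2000 p)]. *)
  exists (c / 32000). split; [lra|].
  intros n m Hnm Hmn Hn Hm.
  (* As [r <= 2 p], the window from [5 r / 8] to [5 r / 8 + 3 p / 4] ends by [2 p], so
     [coef_two_of_three] applies to both exponents throughout. *)
  set (p := Nat.min n m). set (r := Nat.max n m).
  set (L := (5 * r / 8)%nat). set (q := (p / 4)%nat).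
  assert (HL : (8 * L <= 5 * r < 8 * L + 8)%nat).
  { pose proof (Nat.div_mod (5 * r) 8 ltac:(lia)). pose proof (Nat.mod_upper_bound (5 * r) 8 ltac:(lia)).
    fold L in H0. lia. }
  assert (Hq : (4 * q <= p < 4 * q + 4)%nat).
  { pose proof (Nat.div_mod p 4 ltac:(lia)). pose proof (Nat.mod_upper_bound p 4 ltac:(lia)).
    fold q in H0. lia. }
  clearbody L q.
  assert (Hp' : 0 < INR p) by (apply lt_0_INR; lia).
  set (t := c / (2 * INR p) / 1000).
  assert (t0 : 0 < t) by (unfold t; repeat apply Rdiv_lt_0_compat; lra).
  exists (L + 3 * q)%nat.
  apply Rle_trans with (INR q * (t / 2)).
  { assert (Q : INR p <= 8 * INR q).
    { replace 8 with (INR 8) by (simpl; ring). rewrite <- mult_INR. apply le_INR. lia. }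
    replace (c / 32000) with (INR p / 8 * (t / 2)) by (unfold t; field; lra).
    apply Rmult_le_compat_r; lra. }
  assert (pos : forall k, 0 <= Rabs (coef n k) * Rabs (coef k m)).
  { intro k. apply Rmult_le_pos; apply Rabs_pos. }
  apply sum_n_triples; [exact pos|].
  intros j Hj.
  assert (Hk : (L + 3 * j + 3 <= 2 * p)%nat) by lia.
  assert (HkL : (L <= L + 3 * j)%nat) by lia.
  set (i := (L + 3 * j)%nat) in *. clearbody i.
  (* [coef_sym] replaces [coef n k] by [n / k] times [coef k n]; since [k <= 2 n], this costs a
     factor 2. *)
  assert (one : forall k, (0 < k)%nat -> (k <= 2 * p)%nat -> t <= coef k n ^ 2 -> t <= coef k m ^ 2 ->
     t / 2 <= Rabs (coef n k) * Rabs (coef k m)).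
  { intros k k0 Hkp T1 T2.
    assert (P := Rabs_prod_lower _ _ t ltac:(lra) T1 T2).
    assert (k0' : 0 < INR k) by (apply lt_0_INR; lia).
    assert (Kn : INR k <= 2 * INR n).
    { apply Rle_trans with (INR (2 * n)); [apply le_INR; lia | rewrite mult_INR; simpl; lra]. }
    pose proof (coef_sym n k) as Sy.
    assert (A : INR k * Rabs (coef n k) = INR n * Rabs (coef k n)).
    { rewrite <- (Rabs_pos_eq (INR k)), <- (Rabs_pos_eq (INR n)) by apply pos_INR.
      rewrite <- !Rabs_mult. now f_equal. }
    pose proof (Rabs_pos (coef k m)). pose proof (Rabs_pos (coef k n)).
    apply Rmult_le_reg_l with (INR k); [exact k0'|].
    rewrite <- Rmult_assoc, A, Rmult_assoc. nra. }
  (* Two pairs chosen among three indices always meet. *)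
  destruct (coef_two_of_three c n (S i) p Hc H ltac:(lia) ltac:(lia) ltac:(lia) ltac:(lia))
    as [[A1 A2]|[[A1 A2]|[A1 A2]]]; fold t in A1, A2;
  destruct (coef_two_of_three c m (S i) p Hc H ltac:(lia) ltac:(lia) ltac:(lia) ltac:(lia))
    as [[B1 B2]|[[B1 B2]|[B1 B2]]]; fold t in B1, B2;
  pose proof (pos (S i)); pose proof (pos (S (S i))); pose proof (pos (S (S (S i))));
  first [ pose proof (one (S i) ltac:(lia) ltac:(lia) ltac:(assumption) ltac:(assumption)); lra
        | pose proof (one (S (S i)) ltac:(lia) ltac:(lia) ltac:(assumption) ltac:(assumption)); lra
        | pose proof (one (S (S (S i))) ltac:(lia) ltac:(lia) ltac:(assumption) ltac:(assumption)); lra ].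
Qed.

(** * The composition operator *)

Definition blaschke (z : C) : C := ((1 - 2 * z) / (2 - z))%C.

Lemma Cmod_sub_2_ge_1 (z : C) : in_disk z -> 1 < Cmod (2 - z).
Proof.
  unfold in_disk. intro H.
  pose proof (Cmod_triangle (2 - z) z) as T.
  replace (2 - z + z)%C with (RtoC 2) in T by ring.
  rewrite Cmod_R, Rabs_pos_eq in T by lra. lra.
Qed.

Lemma sub_2_neq_0 (z : C) : in_disk z -> (2 - z)%C <> 0.
Proof.
  intros H E. pose proof (Cmod_sub_2_ge_1 z H) as G. rewrite E, Cmod_0 in G. lra.
Qed.

(** [|2 - z|^2 - |1 - 2 z|^2 = 3 (1 - |z|^2)]. *)
Lemma blaschke_in_disk (z : C) : in_disk z -> in_disk (blaschke z).
Proof.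
  intro H. pose proof (Cmod_sub_2_ge_1 z H) as G. unfold blaschke, in_disk.
  rewrite Cmod_div by now apply sub_2_neq_0.
  apply Rlt_div_l; [lra|]. rewrite Rmult_1_l.
  apply Rsqr_incrst_0; try apply Cmod_ge_0.
  rewrite !Rsqr_pow2, !Cmod2_alt.
  assert (Z : Cmod z ^ 2 < 1).
  { unfold in_disk in H. pose proof (Cmod_ge_0 z). nra. }
  rewrite Cmod2_alt in Z. destruct z as [x y]. simpl in *. nra.
Qed.

Lemma in_disk_near (y z : C) : Cmod (y - z) < 1 - Cmod z -> in_disk y.
Proof.
  intro H. unfold in_disk. pose proof (Cmod_triangle (y - z) z) as T.
  replace (y - z + z)%C with y in T by ring. lra.
Qed.

(** The remainder is exactly [-3 (y - z)^2 / ((2 - z)^2 (2 - y))], whose denominator has modulus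
    above 1. *)
Lemma blaschke_taylor_1 (y z : C) :
  in_disk y -> in_disk z ->
  Cmod (blaschke y - blaschke z - (y - z) * (- 3 / ((2 - z) * (2 - z)))) <= 3 * Cmod (y - z) ^ 2.
Proof.
  intros Hy Hz. pose proof (sub_2_neq_0 y Hy) as Ny. pose proof (sub_2_neq_0 z Hz) as Nz.
  replace (blaschke y - blaschke z - (y - z) * (- 3 / ((2 - z) * (2 - z))))%C
    with (- 3 * (y - z) * (y - z) / ((2 - z) * (2 - z) * (2 - y)))%C
    by (unfold blaschke; field; auto).
  rewrite Cmod_div by (repeat apply Cmult_neq_0; auto).
  rewrite !Cmod_mult, Cmod_R, Rabs_left by lra.
  pose proof (Cmod_sub_2_ge_1 z Hz). pose proof (Cmod_sub_2_ge_1 y Hy).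
  set (a := Cmod (2 - z)) in *. set (b := Cmod (2 - y)) in *.
  assert (1 <= a * a * b) by nra. pose proof (pow2_ge_0 (Cmod (y - z))).
  apply Rle_div_l; [lra|]. nra.
Qed.

Lemma blaschke_ex_derive (z : C) : in_disk z -> ex_derive blaschke z.
Proof.
  intro Hz.
  exists (- 3 / ((2 - z) * (2 - z)))%C.
  split; [apply is_linear_scal_l|].
  intros x Hx.
  assert (E := is_filter_lim_locally_unique (V := AbsRing_NormedModule C_AbsRing) z x Hx).
  subst x.
  intro eps. apply (locally_le_locally_norm (V := AbsRing_NormedModule C_AbsRing) z).
  assert (d0 : 0 < Rmin (eps / 3) (1 - Cmod z)).
  { apply Rmin_pos; [pose proof (cond_pos eps); lra | unfold in_disk in Hz; lra]. }
  exists (mkposreal _ d0).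
  intros y Hy. change (Cmod (y - z) < Rmin (eps / 3) (1 - Cmod z)) in Hy.
  change (Cmod (blaschke y - blaschke z - (y - z) * (- 3 / ((2 - z) * (2 - z)))) <= eps * Cmod (y - z)).
  pose proof (Rmin_l (eps / 3) (1 - Cmod z)). pose proof (Rmin_r (eps / 3) (1 - Cmod z)).
  pose proof (Cmod_ge_0 (y - z)).
  assert (Hyd : in_disk y).
  { apply in_disk_near with z. lra. }
  apply Rle_trans with (1 := blaschke_taylor_1 y z Hyd Hz). nra.
Qed.

Lemma blaschke_symbol : symbol blaschke.
Proof.
  split; [exact blaschke_in_disk|]. split; [exact blaschke_ex_derive|].
  exists 0, (RtoC (1 / 2)). unfold in_disk. rewrite !Cmod_R, Rabs_R0, Rabs_pos_eq by lra.
  split; [lra|]. split; [lra|].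
  assert (N2 : RtoC 2 <> 0) by (intro E; apply RtoC_inj in E; lra).
  assert (E1 : blaschke 0 = (1 / 2)%C) by (unfold blaschke; replace (2 - 0)%C with (RtoC 2) by ring; field; exact N2).
  assert (E2 : blaschke (1 / 2)%R = 0).
  { unfold blaschke. rewrite RtoC_div by lra. replace (1 - 2 * (1 / 2))%C with (RtoC 0) by (field; exact N2).
    unfold Cdiv. ring. }
  rewrite E1, E2, <- RtoC_div by lra. intro E. apply RtoC_inj in E. lra.
Qed.

(** * Taylor expansions of the powers of [b] *)

(** The only possible pole of [b^n] is at 2, so any ratio above 1/2 would do; 3/4 leaves room for a
    weight growing like [(4/3)^k]. *)
Lemma coef_geometric (n : nat) :
  exists B, 0 <= B /\ forall k, Rabs (coef n k) <= B * (3 / 4) ^ k.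
Proof.
  induction n as [|n (B & HB & IH)].
  - exists 1. split; [lra|]. intros [|k]; simpl coef.
    + rewrite Rabs_R1. simpl. lra.
    + rewrite Rabs_R0. pose proof (pow_le (3 / 4) (S k) ltac:(lra)). lra.
  (* The induction on [k] closes for a constant [D] once [D + (3/4) B + 2 B <= (3/2) D], that is
     [D >= (11/2) B]. *)
  - exists (6 * B). split; [lra|]. intro k. induction k as [|k IHk].
    + rewrite coef_S_0. specialize (IH 0%nat). simpl in *. apply Rabs_le_between in IH.
      apply Rabs_le. lra.
    + pose proof (coef_S_S n k) as E. pose proof (IH k) as I1. pose proof (IH (S k)) as I2.
      pose proof (pow_le (3 / 4) k ltac:(lra)) as P.
      simpl pow in *. set (r := (3 / 4) ^ k) in *.
      assert (0 <= B * r) by nra.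
      apply Rabs_le_between in I1, I2, IHk. apply Rabs_le. nra.
Qed.

Lemma is_series_C_iff (a : nat -> C) (l : C) :
  is_series a l <-> is_lim_seq (fun n => Cmod (sum_n a n - l)) 0.
Proof.
  split; intro H.
  - apply is_lim_seq_spec. intro eps.
    apply (filterlim_locally_ball_norm (F := eventually) (sum_n a) l) with (eps := eps) in H.
    revert H. apply filter_imp. intros n Hn. rewrite Rminus_0_r, Rabs_pos_eq by apply Cmod_ge_0.
    exact Hn.
  - apply (filterlim_locally_ball_norm (F := eventually) (sum_n a) l). intro eps.
    apply is_lim_seq_spec in H. specialize (H eps). revert H. apply filter_imp.
    intros n Hn. rewrite Rminus_0_r, Rabs_pos_eq in Hn by apply Cmod_ge_0.
    exact Hn.
Qed.

Lemma sum_n_S_C (a : nat -> C) (N : nat) : (sum_n a (S N) : C) = (sum_n a N + a (S N))%C.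
Proof. exact (sum_Sn a N). Qed.

Lemma sum_n_0_C (a : nat -> C) : (sum_n a 0 : C) = a O.
Proof. exact (sum_O a). Qed.

Lemma pow_n_Cpow (z : C) (n : nat) : pow_n (K := C_Ring) z n = (z ^ n)%C.
Proof. induction n as [|n IH]; simpl; [reflexivity|]. rewrite IH. reflexivity. Qed.

Lemma is_pseries_C_iff (a : nat -> C) (z l : C) :
  is_pseries (a : nat -> C_NormedModule) z l
  <-> is_lim_seq (fun n => Cmod (sum_n (fun k => z ^ k * a k)%C n - l)) 0.
Proof.
  unfold is_pseries. rewrite is_series_C_iff.
  assert (E : forall n, sum_n (fun k => scal (pow_n (K := C_AbsRing) z k) (a k : C_NormedModule)) n
     = sum_n (fun k => z ^ k * a k)%C n).
  { intro n. apply sum_n_ext. intro k. rewrite <- pow_n_Cpow. reflexivity. }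
  split; apply is_lim_seq_ext; intro n.
  - exact (f_equal (fun s : C => Cmod (s - l)) (E n)).
  - exact (f_equal (fun s : C => Cmod (s - l)) (eq_sym (E n))).
Qed.

(** The identity [(2 - z) H = (1 - 2 z) G] between generating functions, truncated at [N]; a single
    boundary term remains. *)
Lemma blaschke_sum_C (g h : nat -> R) (z : C) (N : nat) :
  2 * h O = g O -> (forall k, 2 * h (S k) - h k = g (S k) - 2 * g k) ->
  ((2 - z) * sum_n (fun k => z ^ k * h k)%C N
  = (1 - 2 * z) * sum_n (fun k => z ^ k * g k)%C N + (2 * g N - h N)%R * z ^ S N)%C.
Proof.
  intros H0 H. induction N as [|N IH].
  - rewrite !sum_n_0_C. rewrite <- H0. simpl. rewrite RtoC_minus, !RtoC_mult. ring.
  - rewrite !sum_n_S_C, Cmult_plus_distr_l, IH.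
    replace (2 * g N - h N) with (g (S N) - 2 * h (S N)) by (specialize (H N); lra).
    rewrite !RtoC_minus, !RtoC_mult, !Cpow_S. ring.
Qed.

Lemma is_lim_seq_bounded_mult (u v : nat -> R) (B : R) :
  (forall n, 0 <= u n <= B) -> (forall n, 0 <= v n) -> is_lim_seq v 0 ->
  is_lim_seq (fun n => u n * v n) 0.
Proof.
  intros Hu Hv L.
  apply is_lim_seq_le_le with (u := fun _ => 0) (w := fun n => B * v n).
  - intro n. specialize (Hu n). specialize (Hv n). split; nra.
  - apply is_lim_seq_const.
  - replace (Finite 0) with (Rbar_mult B 0) by (simpl; f_equal; ring).
    now apply is_lim_seq_scal_l.
Qed.

Lemma is_pseries_blaschke (g h : nat -> R) (z G : C) (B : R) :
  in_disk z -> (forall k, Rabs (g k) <= B) -> (forall k, Rabs (h k) <= B) ->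
  2 * h O = g O -> (forall k, 2 * h (S k) - h k = g (S k) - 2 * g k) ->
  is_pseries ((fun k => RtoC (g k)) : nat -> C_NormedModule) z G ->
  is_pseries ((fun k => RtoC (h k)) : nat -> C_NormedModule) z (blaschke z * G)%C.
Proof.
  intros Hz Bg Bh H0 H HG. apply is_pseries_C_iff in HG. apply is_pseries_C_iff.
  pose proof (Cmod_sub_2_ge_1 z Hz) as D1. pose proof (sub_2_neq_0 z Hz) as D0.
  pose proof (Cmod_ge_0 z) as Z0.
  assert (Lz : is_lim_seq (fun N => Cmod z ^ S N) 0).
  { apply -> (is_lim_seq_incr_1 (fun N => Cmod z ^ N)). apply is_lim_seq_geom.
    rewrite Rabs_pos_eq; assumption. }
  apply is_lim_seq_le_le with (u := fun _ => 0)
    (w := fun N => Cmod (1 - 2 * z) * Cmod (sum_n (fun k => z ^ k * g k)%C N - G)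
                   + Rabs (2 * g N - h N) * Cmod z ^ S N).
  - intro N. split; [apply Cmod_ge_0|].
    apply Rle_trans with (Cmod (2 - z) * Cmod (sum_n (fun k => z ^ k * h k)%C N - blaschke z * G)).
    + pose proof (Cmod_ge_0 (sum_n (fun k => z ^ k * h k)%C N - blaschke z * G)). nra.
    + rewrite <- Cmod_mult.
      replace ((2 - z) * (sum_n (fun k => z ^ k * h k)%C N - blaschke z * G))%C
        with ((1 - 2 * z) * (sum_n (fun k => z ^ k * g k)%C N - G) + (2 * g N - h N)%R * z ^ S N)%C.
      * apply Rle_trans with (1 := Cmod_triangle _ _).
        rewrite !Cmod_mult, Cmod_R, Cmod_pow. lra.
      * transitivity ((2 - z) * sum_n (fun k => z ^ k * h k)%C N - (1 - 2 * z) * G)%C.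
        { rewrite (blaschke_sum_C g h z N H0 H). ring. }
        unfold blaschke. field. exact D0.
  - apply is_lim_seq_const.
  - replace (Finite 0) with (Finite (0 + 0)) by (f_equal; ring).
    apply is_lim_seq_plus'.
    + apply is_lim_seq_bounded_mult with (Cmod (1 - 2 * z)); [|intro; apply Cmod_ge_0|exact HG].
      intro; split; [apply Cmod_ge_0|lra].
    + apply is_lim_seq_bounded_mult with (3 * B); [|intro; now apply pow_le|exact Lz].
      intro n. split; [apply Rabs_pos|].
      specialize (Bg n). specialize (Bh n). apply Rabs_le_between in Bg, Bh. apply Rabs_le. lra.
Qed.

Lemma coef_bounded (n : nat) : exists B, forall k, Rabs (coef n k) <= B.
Proof.
  destruct (coef_geometric n) as (B & B0 & H). exists B. intro k.
  apply Rle_trans with (1 := H k).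
  assert (0 <= (3 / 4) ^ k <= 1).
  { split; [apply pow_le; lra|]. rewrite <- (pow1 k). apply pow_incr. lra. }
  nra.
Qed.

Lemma taylor_blaschke_pow (n : nat) : taylor_on_disk (fun z => blaschke z ^ n)%C (coef n).
Proof.
  intros z Hz. induction n as [|n IH].
  - apply is_pseries_C_iff. apply is_lim_seq_ext with (fun _ => 0); [|apply is_lim_seq_const].
    intro N. symmetry.
    assert (E : (sum_n (fun k => z ^ k * coef 0 k)%C N : C) = 1).
    { induction N as [|N IHN]; [rewrite sum_n_0_C; simpl; ring|].
      rewrite sum_n_S_C, IHN. simpl coef. ring. }
    rewrite E. replace (1 - blaschke z ^ 0)%C with (RtoC 0) by (simpl; ring). apply Cmod_0.
  - destruct (coef_bounded n) as [B1 H1]. destruct (coef_bounded (S n)) as [B2 H2].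
    apply (is_pseries_blaschke (coef n) (coef (S n)) z (blaschke z ^ n)%C (Rmax B1 B2)); auto.
    + intro k. apply Rle_trans with (1 := H1 k). apply Rmax_l.
    + intro k. apply Rle_trans with (1 := H2 k). apply Rmax_r.
    + rewrite coef_S_0. field.
    + intro k. pose proof (coef_S_S n k). lra.
Qed.

(** * Summability against the weight *)

Lemma weight_subgeometric (beta : nat -> R) :
  (forall n, 0 < beta n) ->
  is_lim_seq (fun n => Rpower (beta n) (1 / INR n)) 1 ->
  exists N, forall n, (N <= n)%nat -> beta n <= (4 / 3) ^ n.
Proof.
  intros Hb H. apply is_lim_seq_spec in H.
  assert (e : 0 < 1 / 3) by lra.
  destruct (H (mkposreal _ e)) as [N HN]. simpl pos in HN.
  (* [S N] excludes [n = 0], where [1 / INR n] is a default value. *)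
  exists (S N). intros n Hn. specialize (HN n ltac:(lia)). apply Rabs_lt_between in HN.
  assert (n0 : 0 < INR n) by (apply lt_0_INR; lia).
  assert (E : beta n = Rpower (beta n) (1 / INR n) ^ n).
  { rewrite <- Rpower_pow by apply exp_pos. rewrite Rpower_mult.
    replace (1 / INR n * INR n) with 1 by (field; lra). now rewrite Rpower_1. }
  rewrite E. apply pow_incr. split; [left; apply exp_pos | lra].
Qed.

(** Eventually the terms are at most [B^2 (3/4)^(2 j) (4/3)^j = B^2 (3/4)^j]. *)
Lemma geometric_weighted_summable (beta b : nat -> R) (B : R) :
  (forall n, 0 < beta n) ->
  is_lim_seq (fun n => Rpower (beta n) (1 / INR n)) 1 ->
  (forall k, Rabs (b k) <= B * (3 / 4) ^ k) ->
  weighted_summable beta b.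
Proof.
  intros Hb Hr H. destruct (weight_subgeometric beta Hb Hr) as [N HN].
  apply (ex_series_incr_n _ N).
  apply (ex_series_le (K := R_AbsRing) (V := R_CompleteNormedModule) _
    (fun k => B ^ 2 * (3 / 4) ^ N * (3 / 4) ^ k)).
  - intro k. change (Rabs (Cmod (b (N + k)%nat) ^ 2 * beta (N + k)%nat) <= B ^ 2 * (3 / 4) ^ N * (3 / 4) ^ k).
    rewrite Cmod_R, pow2_abs. specialize (H (N + k)%nat). specialize (HN (N + k)%nat ltac:(lia)).
    pose proof (Hb (N + k)%nat) as b0.
    rewrite Rabs_pos_eq by (apply Rmult_le_pos; [apply pow2_ge_0|lra]).
    rewrite Rmult_assoc, <- pow_add. set (j := (N + k)%nat) in *.
    apply Rle_trans with ((B * (3 / 4) ^ j) ^ 2 * (4 / 3) ^ j).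
    + apply Rmult_le_compat; [apply pow2_ge_0|lra| |exact HN].
      rewrite <- pow2_abs. apply pow_incr. split; [apply Rabs_pos|exact H].
    + right. replace ((B * (3 / 4) ^ j) ^ 2 * (4 / 3) ^ j)
        with (B ^ 2 * (3 / 4) ^ j * ((3 / 4) ^ j * (4 / 3) ^ j)) by ring.
      rewrite <- Rpow_mult_distr. replace (3 / 4 * (4 / 3)) with 1 by field. rewrite pow1. ring.
  - apply (ex_series_scal (V := R_NormedModule) (B ^ 2 * (3 / 4) ^ N) (fun k => (3 / 4) ^ k)). apply ex_series_geom.
    rewrite Rabs_pos_eq; lra.
Qed.

(** * The operator on polynomials *)

Definition kron (k j : nat) : R := if Nat.eqb k j then 1 else 0.

Lemma kron_same (k : nat) : kron k k = 1.
Proof. unfold kron. now rewrite Nat.eqb_refl. Qed.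

Lemma kron_diff (k j : nat) : k <> j -> kron k j = 0.
Proof. unfold kron. intro H. apply Nat.eqb_neq in H. now rewrite H. Qed.

Lemma sum_n_kron (x : nat -> R) (N j : nat) :
  (sum_n (fun k => x k * kron k j) N : R) = if Nat.leb j N then x j else 0.
Proof.
  induction N as [|N IH].
  - rewrite sum_n_0_R. destruct j as [|j]; [rewrite kron_same; simpl; ring|].
    rewrite kron_diff by lia. simpl. ring.
  - rewrite sum_n_S_R, IH.
    destruct (Nat.leb_spec j N) as [L|L].
    + rewrite kron_diff by lia. rewrite (proj2 (Nat.leb_le j (S N))) by lia. ring.
    + destruct (Nat.eq_dec j (S N)) as [->|D].
      * rewrite kron_same, Nat.leb_refl. ring.
      * rewrite kron_diff by lia. rewrite (proj2 (Nat.leb_gt j (S N))) by lia. ring.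
Qed.

Lemma taylor_pow (n : nat) : taylor_on_disk (fun z => z ^ n)%C (kron n).
Proof.
  intros z _. apply is_pseries_C_iff.
  assert (E : forall N, (sum_n (fun k => z ^ k * kron n k)%C N : C)
                        = if Nat.leb n N then (z ^ n)%C else RtoC 0).
  { induction N as [|N IH].
    - rewrite sum_n_0_C. destruct n as [|n]; [rewrite kron_same; simpl; ring|].
      rewrite kron_diff by lia. simpl. ring.
    - rewrite sum_n_S_C, IH.
      destruct (Nat.leb_spec n N) as [L|L].
      + rewrite kron_diff by lia. rewrite (proj2 (Nat.leb_le n (S N))) by lia. ring.
      + destruct (Nat.eq_dec n (S N)) as [->|D].
        * rewrite kron_same, Nat.leb_refl. ring.
        * rewrite kron_diff by lia. rewrite (proj2 (Nat.leb_gt n (S N))) by lia. ring. }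
  apply is_lim_seq_ext_loc with (fun _ => 0); [|apply is_lim_seq_const].
  exists n. intros N HN. rewrite E, (proj2 (Nat.leb_le n N)) by lia.
  replace (z ^ n - z ^ n)%C with (RtoC 0) by ring. now rewrite Cmod_0.
Qed.

(** Used with monomials for a polynomial [f], and with powers of [b] for its composite with [b]. *)
Lemma taylor_lin_comb (F : nat -> C -> C) (c : nat -> nat -> R) (x : nat -> R) (N : nat) :
  (forall k, taylor_on_disk (F k) (c k)) ->
  taylor_on_disk (fun z => sum_n (fun k => x k * F k z)%C N)
    (fun j => RtoC (sum_n (fun k => x k * c k j) N)).
Proof.
  intros H z Hz.
  assert (S1 : forall k, is_pseries ((fun j => RtoC (x k * c k j)) : nat -> C_NormedModule) z (x k * F k z)%C).
  { intro k. eapply is_pseries_ext; [|apply (is_pseries_scal (K := C_AbsRing) (V := C_NormedModule) (RtoC (x k))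
      (fun j => RtoC (c k j)) z (F k z)); [apply Cmult_comm | now apply H]].
    intro j. rewrite RtoC_mult. reflexivity. }
  induction N as [|N IH].
  - rewrite sum_n_0_C. eapply is_pseries_ext; [|apply S1].
    intro j. simpl. now rewrite sum_n_0_R.
  - rewrite sum_n_S_C.
    eapply is_pseries_ext; [|apply (is_pseries_plus (K := C_AbsRing) (V := C_NormedModule) _ _ z _ _ IH (S1 (S N)))].
    intro j. simpl. rewrite sum_n_S_R, RtoC_plus. reflexivity.
Qed.

Lemma is_series_finite_support (u : nat -> R) (N : nat) :
  (forall j, (N < j)%nat -> u j = 0) -> is_series u (sum_n u N).
Proof.
  intro H.
  assert (E : forall d, (sum_n u (N + d) : R) = sum_n u N).
  { induction d as [|d IH]; [now rewrite Nat.add_0_r|].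
    rewrite Nat.add_succ_r, sum_n_S_R, IH, H by lia. ring. }
  assert (L : is_lim_seq (sum_n u) (sum_n u N)).
  { apply is_lim_seq_ext_loc with (fun _ => sum_n u N); [|apply is_lim_seq_const].
    exists N. intros n Hn. rewrite <- (E (n - N)%nat). f_equal. lia. }
  exact L.
Qed.

Lemma coef_comb_geometric (x : nat -> R) (N : nat) :
  exists B, forall j, Rabs (sum_n (fun k => x k * coef k j) N) <= B * (3 / 4) ^ j.
Proof.
  induction N as [|N (B & IH)].
  - destruct (coef_geometric 0) as (B & _ & H). exists (Rabs (x O) * B). intro j.
    rewrite sum_n_0_R, Rabs_mult, Rmult_assoc.
    apply Rmult_le_compat_l; [apply Rabs_pos | apply H].
  - destruct (coef_geometric (S N)) as (B' & _ & H).
    exists (B + Rabs (x (S N)) * B'). intro j. rewrite sum_n_S_R.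
    apply Rle_trans with (1 := Rabs_triang _ _). rewrite Rmult_plus_distr_r.
    apply Rplus_le_compat; [apply IH|].
    rewrite Rabs_mult, Rmult_assoc. apply Rmult_le_compat_l; [apply Rabs_pos | apply H].
Qed.

Lemma H2_blaschke (beta : nat -> R) :
  (forall n, 0 < beta n) ->
  is_lim_seq (fun n => Rpower (beta n) (1 / INR n)) 1 ->
  H2 beta blaschke.
Proof.
  intros beta_pos beta_root.
  exists (fun j => RtoC (coef 1 j)). split.
  - intros z Hz. rewrite <- (Cpow_1_r (blaschke z)). exact (taylor_blaschke_pow 1 z Hz).
  - destruct (coef_geometric 1) as (B & _ & H).
    now apply geometric_weighted_summable with B.
Qed.

Lemma comp_blaschke_partial_sums (beta x : nat -> R) (M : R) (N J : nat) :
  (forall n, 0 < beta n) ->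
  is_lim_seq (fun n => Rpower (beta n) (1 / INR n)) 1 ->
  (forall (f : C -> C) (a b : nat -> C), H2 beta f -> taylor_on_disk f a ->
     taylor_on_disk (comp_op blaschke f) b -> H2_norm beta b <= M * H2_norm beta a) ->
  sum_n (fun j => sum_n (fun k => x k * coef k j) N ^ 2 * beta j) J
  <= M ^ 2 * sum_n (fun k => x k ^ 2 * beta k) N.
Proof.
  intros beta_pos beta_root HM.
  set (a := fun j => RtoC (sum_n (fun k => x k * kron k j) N)).
  set (b := fun j => RtoC (sum_n (fun k => x k * coef k j) N)).
  set (f := fun z => sum_n (fun k => x k * z ^ k)%C N : C).
  assert (Ta : taylor_on_disk f a) by (apply (taylor_lin_comb _ _ x N taylor_pow)).
  assert (Tb : taylor_on_disk (comp_op blaschke f) b) by (apply (taylor_lin_comb _ _ x N taylor_blaschke_pow)).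
  assert (Sa : is_series (fun j => Cmod (a j) ^ 2 * beta j) (sum_n (fun k => x k ^ 2 * beta k) N)).
  { replace (sum_n (fun k => x k ^ 2 * beta k) N) with (sum_n (fun j => Cmod (a j) ^ 2 * beta j) N).
    - apply is_series_finite_support. intros j Hj. unfold a.
      rewrite sum_n_kron, (proj2 (Nat.leb_gt j N)) by lia. rewrite Cmod_0. ring.
    - apply sum_n_ext_loc. intros j Hj. unfold a.
      rewrite sum_n_kron, (proj2 (Nat.leb_le j N)) by lia. now rewrite Cmod_R, pow2_abs. }
  assert (Sb : weighted_summable beta b).
  { destruct (coef_comb_geometric x N) as [B HB]. now apply geometric_weighted_summable with B. }
  assert (Hf : H2 beta f).
  { exists a. split; [exact Ta|]. now exists (sum_n (fun k => x k ^ 2 * beta k) N). }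
  specialize (HM f a b Hf Ta Tb). unfold H2_norm in HM.
  rewrite (is_series_unique _ _ Sa) in HM.
  assert (A0 : 0 <= sum_n (fun k => x k ^ 2 * beta k) N).
  { apply Rle_trans with (sum_n (fun _ => 0) N).
    - rewrite sum_n_const. lra.
    - apply sum_n_Rle. intro k. apply Rmult_le_pos; [apply pow2_ge_0 | left; apply beta_pos]. }
  assert (b0 : forall j, 0 <= Cmod (b j) ^ 2 * beta j).
  { intro j. apply Rmult_le_pos; [apply pow2_ge_0 | left; apply beta_pos]. }
  pose proof (Series_correct _ Sb) as Sb'.
  apply Rle_trans with (sum_n (fun j => Cmod (b j) ^ 2 * beta j) J).
  { right. apply sum_n_ext. intro j. unfold b. now rewrite Cmod_R, pow2_abs. }
  apply Rle_trans with (1 := sum_n_le_is_series _ _ J b0 Sb').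
  assert (B0 : 0 <= Series (fun j => Cmod (b j) ^ 2 * beta j)).
  { apply Rle_trans with (sum_n (fun j => Cmod (b j) ^ 2 * beta j) 0).
    - rewrite sum_n_0_R. apply b0.
    - now apply sum_n_le_is_series. }
  rewrite <- (sqrt_sqrt _ B0), <- (sqrt_sqrt _ A0).
  set (p := sqrt (Series (fun j => Cmod (b j) ^ 2 * beta j))) in *.
  set (q := sqrt (sum_n (fun k => x k ^ 2 * beta k) N)) in *.
  assert (0 <= p) by apply sqrt_pos. nra.
Qed.

Lemma comp_blaschke_weight_ratio (beta : nat -> R) (M : R) (N n m : nat) :
  (forall n, 0 < beta n) ->
  is_lim_seq (fun n => Rpower (beta n) (1 / INR n)) 1 ->
  (forall (f : C -> C) (a b : nat -> C), H2 beta f -> taylor_on_disk f a ->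
     taylor_on_disk (comp_op blaschke f) b -> H2_norm beta b <= M * H2_norm beta a) ->
  sum_n (fun k => Rabs (coef n k) * Rabs (coef k m)) N ^ 2 * beta m <= M ^ 4 * beta n.
Proof.
  intros beta_pos beta_root HM.
  (* These signs remove all cancellation in the coefficient of [z^m] of the image and leave the norm
     of the truncation of [b^n] unchanged. *)
  set (x := fun k => if Rle_lt_dec 0 (coef k m) then Rabs (coef n k) else - Rabs (coef n k)).
  assert (X1 : forall k, x k * coef k m = Rabs (coef n k) * Rabs (coef k m)).
  { intro k. unfold x. destruct (Rle_lt_dec 0 (coef k m)).
    - rewrite (Rabs_pos_eq (coef k m)); auto.
    - rewrite (Rabs_left (coef k m)); auto. ring. }
  assert (X2 : forall k, x k ^ 2 = coef n k ^ 2).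
  { intro k. rewrite <- (pow2_abs (coef n k)). unfold x. destruct (Rle_lt_dec 0 (coef k m)); ring. }
  assert (R1 := comp_blaschke_partial_sums beta x M N m beta_pos beta_root HM).
  assert (R2 := comp_blaschke_partial_sums beta (fun k => kron k n) M n N beta_pos beta_root HM).
  cbv beta in R2.
  (* Only the term [j = m] is kept. *)
  assert (L1 : sum_n (fun k => Rabs (coef n k) * Rabs (coef k m)) N ^ 2 * beta m
    <= sum_n (fun j => sum_n (fun k => x k * coef k j) N ^ 2 * beta j) m).
  { rewrite <- (sum_n_ext _ _ N X1).
    assert (p : forall j, 0 <= sum_n (fun k => x k * coef k j) N ^ 2 * beta j).
    { intro j. apply Rmult_le_pos; [apply pow2_ge_0 | left; apply beta_pos]. }
    destruct m as [|m'].
    - rewrite sum_n_0_R. lra.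
    - rewrite sum_n_S_R.
      assert (0 <= sum_n (fun j => sum_n (fun k => x k * coef k j) N ^ 2 * beta j) m').
      { apply Rle_trans with (sum_n (fun _ => 0) m').
        - rewrite sum_n_const. lra.
        - now apply sum_n_Rle. }
      lra. }
  assert (L2 : (sum_n (fun k => x k ^ 2 * beta k) N : R)
     = sum_n (fun j => sum_n (fun k => kron k n * coef k j) n ^ 2 * beta j) N).
  { apply sum_n_ext. intro j. rewrite X2.
    rewrite (sum_n_ext (fun k => kron k n * coef k j) (fun k => coef k j * kron k n))
      by (intro; apply Rmult_comm).
    now rewrite sum_n_kron, Nat.leb_refl. }
  assert (L3 : (sum_n (fun k => kron k n ^ 2 * beta k) n : R) = beta n).
  { assert (E : forall k, kron k n ^ 2 * beta k = beta k * kron k n).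
    { intro k. unfold kron. destruct (Nat.eqb k n); ring. }
    rewrite (sum_n_ext _ _ n E). now rewrite sum_n_kron, Nat.leb_refl. }
  rewrite L2 in R1. rewrite L3 in R2.
  apply Rle_trans with (1 := L1). apply Rle_trans with (1 := R1).
  replace (M ^ 4 * beta n) with (M ^ 2 * (M ^ 2 * beta n)) by ring.
  apply Rmult_le_compat_l; [apply pow2_ge_0 | exact R2].
Qed.

(** * Slow oscillation of the weight *)

Lemma weight_ratio_bounded (beta : nat -> R) (N : nat) :
  (forall n, 0 < beta n) ->
  exists K, forall n m, (n < N)%nat -> (m < N)%nat -> beta m <= K * beta n.
Proof.
  intro beta_pos.
  assert (H : exists a b, 0 < a /\ 0 < b /\ forall n, (n < N)%nat -> a <= beta n <= b).
  { induction N as [|N' (a & b & Ha & Hb & H)].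
    - exists 1, 1. split; [lra|]. split; [lra|]. lia.
    - pose proof (beta_pos N') as P.
      exists (Rmin a (beta N')), (Rmax b (beta N')).
      split; [now apply Rmin_pos|]. split; [apply Rlt_le_trans with (1 := Hb), Rmax_l|].
      intros n Hn.
      pose proof (Rmin_l a (beta N')). pose proof (Rmin_r a (beta N')).
      pose proof (Rmax_l b (beta N')). pose proof (Rmax_r b (beta N')).
      destruct (Nat.eq_dec n N') as [->|D]; [lra|]. specialize (H n ltac:(lia)). lra. }
  destruct H as (a & b & Ha & Hb & H). exists (b / a). intros n m Hn Hm.
  destruct (H n Hn), (H m Hm).
  apply Rle_trans with b; [assumption|].
  replace b with (b / a * a) at 1 by (field; lra).
  apply Rmult_le_compat_l; [|assumption].
  left. now apply Rdiv_lt_0_compat.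
Qed.

Theorem theorem2p2 (beta : nat -> R)
  (beta_pos : forall n : nat, 0 < beta n)
  (beta_root : is_lim_seq (fun n : nat => Rpower (beta n) (1 / INR n)) 1)
  (all_bounded : forall phi : C -> C,
     symbol phi -> H2 beta phi -> bounded_comp_op beta phi) :
  slowly_oscillating beta.
Proof.
  destruct (all_bounded blaschke blaschke_symbol (H2_blaschke beta beta_pos beta_root)) as [_ [M HM]].
  destruct coef_overlap as (d & d0 & Hd).
  (* If one of [n], [m] is below 8, the other is at most 14. *)
  destruct (weight_ratio_bounded beta 16 beta_pos) as [K HK].
  set (A := Rmax 2 (Rmax K (M ^ 4 / d ^ 2))).
  assert (A2 : 2 <= A) by apply Rmax_l.
  assert (AK : K <= A) by (eapply Rle_trans; [apply Rmax_l | apply Rmax_r]).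
  assert (AM : M ^ 4 / d ^ 2 <= A) by (eapply Rle_trans; [apply Rmax_r | apply Rmax_r]).
  assert (up : forall n m, (n <= 2 * m)%nat -> (m <= 2 * n)%nat -> beta m <= A * beta n).
  { intros n m Hnm Hmn. pose proof (beta_pos n) as bn. pose proof (beta_pos m) as bm.
    destruct (Nat.le_gt_cases 8 n) as [n8|n8]; [destruct (Nat.le_gt_cases 8 m) as [m8|m8]|].
    - destruct (Hd n m Hnm Hmn n8 m8) as [N HN].
      pose proof (comp_blaschke_weight_ratio beta M N n m beta_pos beta_root HM) as R.
      set (s := sum_n (fun k => Rabs (coef n k) * Rabs (coef k m)) N) in *.
      assert (d2 : 0 < d ^ 2) by nra.
      assert (ds : d ^ 2 <= s ^ 2) by (apply pow_incr; lra).
      apply Rle_trans with (M ^ 4 / d ^ 2 * beta n); [|nra].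
      replace (M ^ 4 / d ^ 2 * beta n) with (M ^ 4 * beta n / d ^ 2) by (field; lra).
      apply Rle_div_r; [lra|]. nra.
    - apply Rle_trans with (K * beta n); [apply HK; lia | nra].
    - apply Rle_trans with (K * beta n); [apply HK; lia | nra]. }
  exists (/ A), A.
  split; [apply Rinv_0_lt_compat; lra|].
  split; [rewrite <- Rinv_1; apply Rinv_lt_contravar; lra|].
  split; [lra|].
  (* The range condition is symmetric, so the lower bound is [up] with [n] and [m] exchanged. *)
  intros n m Hnm Hmn. split; [|now apply up].
  apply Rmult_le_reg_l with A; [lra|].
  rewrite <- Rmult_assoc, Rinv_r, Rmult_1_l by lra. now apply up.
Qed.
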